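(* Let $\alpha:\mathbf{ST}\to\mathbf{PQSym}^*$ be the linear map given, for $f\in\mathbf{ST}_n$, by $\alpha(f)=\alpha_n(f)=\sum_{h\in PF_n,\ \mathrm{std}(h)=f}h$ (and $\alpha(1)=1$). Then $\alpha$ is injective, and for all $f,g\in\mathbf{ST}$: $\alpha(f\succ_qg)=\alpha(f)\succ_q\alpha(g)$, $\alpha(f\cdot_qg)=\alpha(f)\cdot_q\alpha(g)$, $\alpha(f\prec_qg)=\alpha(f)\prec_q\alpha(g)$, and $\Delta\circ\alpha=(\alpha\otimes\alpha)\circ\Delta$. Hence $\mathbf{ST}(q)$ is a sub-$q$-tridendriform bialgebra of $\mathbf{PQSym}^*(q)$.
   Context: Words: maps $h:[n]\to\mathbb{Z}_{>0}$ identified with $(h(1),\dots,h(n))$; $\max(h)$ largest value; $hk$ concatenation; $\cap(h,k)=|\mathrm{Im}(h)\cap\mathrm{Im}(k)|$; $h$ surjective if $\mathrm{Im}(h)=[\max(h)]$. $\mathrm{std}(h)$ is the unique surjective word $s$ of the same length with $h(i)<h(j)\iff s(i)<s(j)$. $\mathbf{ST}(q)$: $\mathbf{ST}_n$ the set of surjections from $[n]$ onto some $[r]$, $\mathbf{ST}=\bigoplus_{n\ge1}\mathbb{K}[\mathbf{ST}_n]$; for $f\in\mathbf{ST}_n$, $g\in\mathbf{ST}_m$: $f\succ_qg=\sum_{\max(h)<\max(k)}q^{\cap(h,k)}hk$, $f\cdot_qg=\sum_{\max(h)=\max(k)}q^{\cap(h,k)-1}hk$, $f\prec_qg=\sum_{\max(h)>\max(k)}q^{\cap(h,k)}hk$,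 over pairs of words $(h,k)$ with $hk$ surjective, $\mathrm{std}(h)=f$, $\mathrm{std}(k)=g$. Coproduct: $\Delta(1)=1\otimes1$, and for $f\in\mathbf{ST}_n$ with $\max(f)=r$, $\Delta(f)=\sum_{j=0}^rf|^{[j]}\otimes\mathrm{std}(f|^{\{j+1,\dots,r\}})$, where $f|^K=(f(j_1),\dots,f(j_l))$ with $\{j_1<\dots<j_l\}=f^{-1}(K)$, empty word $=1$. $\mathbf{PQSym}^*(q)$: $PF_n$ the set of $n$-parking functions, i.e. $f=f^\uparrow\circ\sigma$ with $\sigma\in S_n$ and $f^\uparrow:[n]\to[n]$ non-decreasing with $f^\uparrow(i)\le i$; every surjective word is a parking function. $\mathrm{Park}$: for non-decreasing $f^\uparrow$, $\mathrm{Park}(f^\uparrow)(1)=1$, $\mathrm{Park}(f^\uparrow)(j)=\min\{\mathrm{Park}(f^\uparrow)(j-1)+f^\uparrow(j)-f^\uparrow(j-1),j\}$; for $f=f^\uparrow\circ\sigma$, $\mathrm{Park}(f)=\mathrm{Park}(f^\uparrow)\circ\sigma$. Products on $\mathbf{PQSym}^*=\bigoplus_n\mathbb{K}[PF_n]$: same formulas as for $\mathbf{ST}$ but over pairs $(h,k)$ with $hk$ a parking function, $\mathrm{Park}(h)=f$, $\mathrm{Park}(k)=g$. Coproduct: with $f\times_Pg=(f(1),\dots,f(n),g(1)+n,\dots,g(m)+n)$, $\Delta(f)=\sum_jf^j_{(1)}\otimes f^j_{(2)}$ over all $0\le j\le n$ such that $f=(f^j_{(1)}\times_Pf^j_{(2)})\circ\delta_j$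 for some $f^j_{(1)}\in PF_j$, $f^j_{(2)}\in PF_{n-j}$ and $\delta_j\in S_n$ with $\delta_j^{-1}$ a $(j,n-j)$-shuffle; $\Delta(1)=1\otimes1$. *)

(* Defs.v *)
From HB Require Import structures.
From mathcomp Require Import all_boot all_algebra.
Set Implicit Arguments.
Unset Strict Implicit.
Unset Printing Implicit Defensive.
Import GRing.Theory.

(* A word h : [n] -> Z_{>0} is the list (h(1),...,h(n)). *)
Definition word := seq nat.

Definition maxw (w : word) : nat := foldr maxn 0 w.

Definition surjective_w (w : word) : bool :=
  all (fun x => 0 < x) w && all (fun i => i \in w) (iota 1 (maxw w)).

(* std(h): the surjective word with the same relative order *)
Definition std (h : word) : word :=
  [seq size (undup [seq y <- h | y <= x]) | x <- h].

Definition capw (h k : word) : nat := size (undup [seq x <- h | x \in k]).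

(* parking functions: h = h^up o sigma with h^up non-decreasing,
   0 < h^up(i) <= i; h^up is the sorted rearrangement of h. *)
Definition is_pf (h : word) : bool :=
  all (fun x => 0 < x) h &&
  all (fun i => nth 0 (sort leq h) i <= i.+1) (iota 0 (size h)).

(* Park on a non-decreasing word:
   Park(1) = 1, Park(j) = min(Park(j-1) + f(j) - f(j-1), j). *)
Fixpoint park_aux (pv pp j : nat) (s : seq nat) : seq nat :=
  if s is x :: s' then
    let p := minn (pp + (x - pv)) j in p :: park_aux x p j.+1 s'
  else [::].
Definition park_sorted (s : seq nat) : seq nat :=
  if s is x :: s' then 1 :: park_aux x 1 2 s' else [::].
(* Park(f^up o sigma) = Park(f^up) o sigma *)
Definition Park (h : word) : word :=
  let s := sort leq h in
  let p := park_sorted s in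
  [seq nth 0 p (index x s) | x <- h].

Fixpoint words_of (n N : nat) : seq word :=
  if n is n'.+1 then [seq x :: w | x <- iota 1 N, w <- words_of n' N]
  else [:: [::]].

Fixpoint masks_of (n : nat) : seq bitseq :=
  if n is n'.+1 then [seq b :: m | b <- [:: true; false], m <- masks_of n']
  else [:: [::]].

Section Algebra.
Variable K : fieldType.
Variable q : K.

(* Elements of K[words] as formal finite linear combinations;
   equality is equality of all coefficients. The empty word is the unit 1. *)
Definition lc := seq (K * word).
Definition coef (x : lc) (w : word) : K := (\sum_(p <- x | p.2 == w) p.1)%R.
Definition lc_eq (x y : lc) : Prop := forall w, coef x w = coef y w.

(* Elements of the tensor square, on the basis of pairs of words. *)
Definition lc2 := seq (K * (word * word)).
Definition coef2 (x : lc2) (w : word * word) : K :=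
  (\sum_(p <- x | p.2 == w) p.1)%R.
Definition lc2_eq (x y : lc2) : Prop := forall w, coef2 x w = coef2 y w.

(* membership in ST (including the unit 1 = empty word) *)
Definition in_ST (x : lc) : bool := all (fun p => surjective_w p.2) x.
Definition in_ST_pos (x : lc) : bool :=
  all (fun p => surjective_w p.2 && (0 < size p.2)) x.

Definition pairs_of (n m : nat) : seq (word * word) :=
  [seq (h, k) | h <- words_of n (n + m), k <- words_of m (n + m)].

Definition op_b (good : word -> bool) (norm : word -> word)
    (rel : nat -> nat -> bool) (e : word -> word -> nat) (f g : word) : lc :=
  [seq ((q ^+ e hk.1 hk.2)%R, hk.1 ++ hk.2)
  | hk <- pairs_of (size f) (size g)
  & [&& good (hk.1 ++ hk.2), norm hk.1 == f, norm hk.2 == g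
      & rel (maxw hk.1) (maxw hk.2)]].

Definition exp_lt (h k : word) : nat := capw h k.
Definition exp_eq (h k : word) : nat := (capw h k).-1.

Definition ST_succ := op_b surjective_w std ltn exp_lt.
Definition ST_dot  := op_b surjective_w std eqn exp_eq.
Definition ST_prec := op_b surjective_w std (fun a b => b < a) exp_lt.
Definition PQ_succ := op_b is_pf Park ltn exp_lt.
Definition PQ_dot  := op_b is_pf Park eqn exp_eq.
Definition PQ_prec := op_b is_pf Park (fun a b => b < a) exp_lt.

Definition lin2 (op : word -> word -> lc) (x y : lc) : lc :=
  flatten [seq flatten [seq [seq ((a.1 * b.1 * c.1)%R, c.2) | c <- op a.2 b.2]
                        | b <- y] | a <- x].

Definition alpha_b (f : word) : lc :=
  [seq (1%R, h) | h <- words_of (size f) (size f) & is_pf h && (std h == f)].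
Definition alpha (x : lc) : lc :=
  flatten [seq [seq ((a.1 * c.1)%R, c.2) | c <- alpha_b a.2] | a <- x].

Definition alpha2 (x : lc2) : lc2 :=
  flatten [seq flatten [seq [seq ((a.1 * b.1 * c.1)%R, (b.2, c.2))
                             | c <- alpha_b a.2.2] | b <- alpha_b a.2.1]
          | a <- x].

Definition DeltaST_b (f : word) : lc2 :=
  [seq (1%R, ([seq x <- f | x <= j], std [seq x <- f | j < x]))
  | j <- iota 0 (maxw f).+1].

(* coproduct of PQSym^*: sum over j and over the (j,n-j)-shuffles
   (encoded by the mask m of the positions sent to {1..j}) such that
   f = (f1 x_P f2) o delta_j with f1 in PF_j, f2 in PF_{n-j}. *)
Definition DeltaPQ_b (f : word) : lc2 :=
  flatten [seq
    [seq (1%R, (mask m f, [seq x - j | x <- mask (map negb m) f]))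
    | m <- masks_of (size f)
    & [&& count id m == j, is_pf (mask m f),
          all (fun x => j < x) (mask (map negb m) f)
        & is_pf [seq x - j | x <- mask (map negb m) f]]]
  | j <- iota 0 (size f).+1].

Definition Delta_lift (D : word -> lc2) (x : lc) : lc2 :=
  flatten [seq [seq ((a.1 * c.1)%R, c.2) | c <- D a.2] | a <- x].

Definition DeltaST := Delta_lift DeltaST_b.
Definition DeltaPQ := Delta_lift DeltaPQ_b.

End Algebra.

(* Main.v *)
(** Both normalisations relabel letters increasingly: [std w] sends a letter to
    its rank among the letters of [w], and [Park w] is strictly increasing on
    the letters of [w].  Hence [std (Park w) = std w], while maxima comparisons
    and common letter counts are unchanged by [std].  In a product, a word [w]
    determines its factors as a prefix and a suffix, so the coefficients of
    [w] on both sides of each product identity are single powers of [q] subject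
    to the same conditions.
    In the coproducts, the coefficients of [(u, v)] are 0 or 1: a parking
    function [h] with [std h = f] that splits into [u] (letters at most
    [size u]) and [v] (the others, shifted) exists exactly when [f] can be cut
    at some value into [std u] and a word with standardisation [std v], and
    [h] is then unique. *)
Require Import Defs.
From HB Require Import structures.
From mathcomp Require Import all_boot all_algebra.
From mathcomp Require Import zify.
Set Implicit Arguments.
Unset Strict Implicit.
Unset Printing Implicit Defensive.
Import GRing.Theory.

(** * Ranks of letters and standardisation *)

Definition rank (w : word) (x : nat) := size (undup [seq y <- w | y <= x]).

Lemma stdE w : std w = map (rank w) w. Proof. by []. Qed.

Lemma size_std w : size (std w) = size w.
Proof. by rewrite size_map. Qed.

Lemma size_undup_sub (T : eqType) (s t : seq T) :
  {subset s <= t} -> size (undup s) <= size (undup t).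
Proof.
move=> st; apply: uniq_leq_size; first exact: undup_uniq.
by move=> x; rewrite !mem_undup => /st.
Qed.

Lemma size_undup_map_in (T U : eqType) (f : T -> U) (s : seq T) :
  {in s &, injective f} -> size (undup (map f s)) = size (undup s).
Proof.
move=> fI; rewrite -(size_map f (undup s)); apply: perm_size.
apply: uniq_perm; first exact: undup_uniq.
  rewrite map_inj_in_uniq ?undup_uniq // => x y.
  by rewrite !mem_undup; apply: fI.
move=> y; rewrite mem_undup; apply/mapP/mapP => -[x xs ->];
by exists x => //; rewrite ?mem_undup // -mem_undup.
Qed.

Lemma rank_homo w : {homo rank w : x y / x <= y}.
Proof.
move=> x y xy; apply: size_undup_sub => z; rewrite !mem_filter.
by case/andP => zx ->; rewrite (leq_trans zx).
Qed.

Lemma rank_le w x y : x \in 0 :: w -> (rank w x <= rank w y) = (x <= y).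
Proof.
rewrite inE => xw; case: (leqP x y) => [/rank_homo -> //|yx].
case/orP: xw => [/eqP x0|xw]; first by rewrite x0 in yx.
apply/negbTE; rewrite -ltnNge.
have -> : (rank w y).+1 = size (x :: undup [seq z <- w | z <= y]) by [].
apply: uniq_leq_size.
  by rewrite /= mem_undup mem_filter undup_uniq andbT leqNgt yx.
move=> z; rewrite inE !mem_undup !mem_filter => /orP[/eqP->|/andP[zy ->]].
  by rewrite leqnn.
by rewrite andbT (leq_trans zy) // ltnW.
Qed.

Lemma rank_lt w x y : y \in 0 :: w -> (rank w x < rank w y) = (x < y).
Proof. by move=> yw; rewrite !ltnNge rank_le. Qed.

Lemma rank_inj w : {in w &, injective (rank w)}.
Proof.
move=> x y xw yw /eqP; rewrite eqn_leq !rank_le ?inE ?xw ?yw ?orbT //.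
by rewrite -eqn_leq => /eqP.
Qed.

Lemma rank_gt0 w x : x \in w -> 0 < rank w x.
Proof.
move=> xw; suff : x \in undup [seq y <- w | y <= x] by rewrite /rank; case: undup.
by rewrite mem_undup mem_filter leqnn.
Qed.

Lemma rank_size w x : rank w x <= size (undup w).
Proof. by apply: size_undup_sub => y; rewrite mem_filter => /andP[]. Qed.

Lemma mono_in_inj (phi : nat -> nat) (w : word) :
  {in w &, {mono phi : x y / x <= y}} -> {in w &, injective phi}.
Proof.
move=> m x y xw yw /eqP; rewrite eqn_leq !m //.
by rewrite -eqn_leq => /eqP.
Qed.

Lemma rank_map (phi : nat -> nat) (w : word) x :
  {in w &, {mono phi : x y / x <= y}} -> x \in w ->
  rank (map phi w) (phi x) = rank w x.
Proof.
move=> m xw; rewrite /rank filter_map.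
have -> : [seq y <- w | preim phi (leq^~ (phi x)) y] = [seq y <- w | y <= x].
  by apply: eq_in_filter => y yw /=; rewrite m.
apply: size_undup_map_in => y z; rewrite !mem_filter => /andP[_ yw] /andP[_ zw].
exact: (mono_in_inj m).
Qed.

Lemma std_map (phi : nat -> nat) (w : word) :
  {in w &, {mono phi : x y / x <= y}} -> std (map phi w) = std w.
Proof.
move=> m; rewrite !stdE -map_comp; apply/eq_in_map => x xw /=.
exact: rank_map.
Qed.

Lemma rank_mono w (v : word) : {subset v <= w} ->
  {in v &, {mono rank w : x y / x <= y}}.
Proof. by move=> vw x y xv yv; rewrite rank_le // inE (vw x) ?orbT. Qed.

Lemma std_map_rank w (v : word) : {subset v <= w} -> std (map (rank w) v) = std v.
Proof. by move=> vw; rewrite std_map //; apply: rank_mono. Qed.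

(** Inverse relabelling to [rank w], read off by position; it serves to build words with a
    prescribed standardisation. *)
Definition unrank (w : word) (y : nat) := nth 0 w (index y (std w)).

Lemma rankK w : {in w, cancel (rank w) (unrank w)}.
Proof. by move=> x xw; apply: nth_index_map => //; apply: rank_inj. Qed.

Lemma map_unrank w : map (unrank w) (std w) = w.
Proof.
rewrite stdE -map_comp -[RHS]map_id; apply/eq_in_map => x xw /=.
exact: rankK.
Qed.

Lemma unrank_mono w : {in std w &, {mono unrank w : x y / x <= y}}.
Proof.
move=> _ _ /mapP[x xw ->] /mapP[y yw ->]; rewrite -/(rank w x) -/(rank w y).
by rewrite !rankK // rank_le // inE xw orbT.
Qed.

(** * Maxima and surjective words *)

Lemma maxw_ge w x : x \in w -> x <= maxw w.
Proof.
elim: w => //= y w IH; rewrite inE leq_max => /orP[/eqP->|/IH ->].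
  by rewrite leqnn.
by rewrite orbT.
Qed.

Lemma maxw_mem w : maxw w \in 0 :: w.
Proof.
elim: w => //= y w IH; rewrite /maxn; case: ltnP => _; rewrite ?inE ?eqxx ?orbT //.
by move: IH; rewrite inE -/(maxw w) => /orP[->|->]; rewrite ?orbT.
Qed.

Lemma maxw_leq w c : (maxw w <= c) = all (leq^~ c) w.
Proof. by elim: w => //= y w <-; rewrite geq_max. Qed.

Lemma maxw_map (phi : nat -> nat) w : phi 0 = 0 -> {homo phi : x y / x <= y} ->
  maxw (map phi w) = phi (maxw w).
Proof.
move=> phi0 m; elim: w => //= y w ->; rewrite /maxn -/(maxw w).
have [/ltnW/m le|/m le] := ltnP y (maxw w); case: ltnP => // le'; lia.
Qed.

Lemma surjP w : surjective_w w ->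
  forall x, (x \in w) = (0 < x <= maxw w).
Proof.
case/andP => /allP pos /allP sur x; apply/idP/andP.
  by move=> xw; rewrite pos // maxw_ge.
by move=> x1; apply: sur; rewrite mem_iota add1n ltnS; apply/andP.
Qed.

(** The distinct letters of [w] up to [x] are exactly [1, ..., x]. *)
Lemma surj_rank w x : surjective_w w -> x <= maxw w -> rank w x = x.
Proof.
move=> sw xm; rewrite -[RHS](size_iota 1); apply: perm_size.
apply: uniq_perm; rewrite ?undup_uniq ?iota_uniq // => y.
rewrite mem_undup mem_filter surjP // mem_iota; lia.
Qed.

Lemma std_surj w : surjective_w w -> std w = w.
Proof.
move=> sw; rewrite stdE -[RHS]map_id; apply/eq_in_map => x xw /=.
by rewrite surj_rank // maxw_ge.
Qed.

(** Pigeonhole: [rank w] is injective on the distinct letters and takes values in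
    [1, ..., size (undup w)], hence reaches all of them. *)
Lemma mem_std w y : (y \in std w) = (0 < y <= size (undup w)).
Proof.
have sub : {subset map (rank w) (undup w) <= iota 1 (size (undup w))}.
  move=> _ /mapP[x xw ->]; rewrite mem_undup in xw.
  by rewrite mem_iota rank_gt0 //= add1n ltnS rank_size.
have u : uniq (map (rank w) (undup w)).
  rewrite map_inj_in_uniq ?undup_uniq // => x z.
  by rewrite !mem_undup; apply: rank_inj.
have [|_ e] := uniq_min_size u sub; first by rewrite size_map size_iota.
have <- : (y \in iota 1 (size (undup w))) = (0 < y <= size (undup w)).
  by rewrite mem_iota add1n ltnS.
rewrite -e stdE.
by apply/mapP/mapP => -[x xw ->]; exists x => //; rewrite ?mem_undup // -mem_undup.
Qed.

Lemma maxw_std w : maxw (std w) = size (undup w).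
Proof.
apply/eqP; rewrite eqn_leq maxw_leq; apply/andP; split.
  by apply/allP => y; rewrite mem_std => /andP[].
have := mem_std w (size (undup w)); rewrite leqnn andbT.
by case: (size _) => // n /maxw_ge.
Qed.

Lemma surj_std w : surjective_w (std w).
Proof.
apply/andP; split; apply/allP => y; first by rewrite mem_std => /andP[].
by rewrite mem_iota maxw_std mem_std add1n ltnS.
Qed.

(** * Parking functions by counting small letters *)

Lemma is_pf_posP w : is_pf w -> forall x, x \in w -> 0 < x.
Proof. by case/andP => /allP. Qed.

(** The first [c] entries of the sorted word are at most [c]. With its converse, this replaces
    sorting by a count that ignores the order of the letters. *)
Lemma is_pf_count w c : is_pf w -> c <= size w -> c <= count (leq^~ c) w.
Proof.
case/andP => _ /allP p cw; rewrite -(permP (permEl (perm_sort leq w))).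
set s := sort leq w in p *; rewrite -(cat_take_drop c s) count_cat.
apply: leq_trans (leq_addr _ _).
have sz : size (take c s) = c by rewrite size_takel // size_sort.
rewrite -{1}sz leq_eqVlt; apply/orP; left; rewrite eq_sym -all_count.
apply/(all_nthP 0) => i; rewrite sz => ic; rewrite nth_take //.
by apply: leq_trans (p i _) _ => //; rewrite mem_iota /=; lia.
Qed.

Lemma count_is_pf w : (forall x, x \in w -> 0 < x) ->
  (forall c, c <= size w -> c <= count (leq^~ c) w) -> is_pf w.
Proof.
move=> pos p; apply/andP; split; first exact/allP.
apply/allP => i; rewrite mem_iota /= add0n => iw.
rewrite leqNgt; apply/negP => lt.
have := p i.+1 iw; rewrite -(permP (permEl (perm_sort leq w))).
set s := sort leq w in lt *; rewrite -(cat_take_drop i s) count_cat.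
(* If the sorted entry at index [i] exceeds [i.+1], so do all later ones, leaving at most [i]
   letters that are at most [i.+1]. *)
have -> : count (leq^~ i.+1) (drop i s) = 0.
  apply/eqP; rewrite -leqn0 leqNgt -has_count; apply/negP => /(has_nthP 0)[k].
  rewrite size_drop nth_drop size_sort => kw le.
  have : nth 0 s i <= nth 0 s (i + k).
    apply: (sorted_leq_nth leq_trans leqnn); rewrite ?inE ?size_sort; try lia.
    exact: (sort_sorted leq_total).
  lia.
rewrite addn0 => /leq_trans/(_ (count_size _ _)).
by rewrite size_takel ?ltnn // size_sort ltnW.
Qed.

(** The bound on the entries of any rearrangement [t] already gives the counts, so for [Park] no
    sortedness of the image has to be shown. *)
Lemma is_pf_perm w t : perm_eq w t -> (forall x, x \in t -> 0 < x) ->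
  (forall i, i < size t -> nth 0 t i <= i.+1) -> is_pf w.
Proof.
move=> wt pos p; apply: count_is_pf => [x|c cw].
  by rewrite (perm_mem wt); apply: pos.
rewrite (permP wt) -(cat_take_drop c t) count_cat.
rewrite (perm_size wt) in cw; apply: leq_trans (leq_addr _ _).
have sz : size (take c t) = c by rewrite size_takel.
rewrite -{1}sz leq_eqVlt; apply/orP; left; rewrite eq_sym -all_count.
apply/(all_nthP 0) => i; rewrite sz => ic; rewrite nth_take //.
by apply: leq_trans (p i _) _ => //; lia.
Qed.

(** For [c] up to the maximum, the letters [1, ..., c] all occur; beyond it, every letter is
    counted. *)
Lemma surj_is_pf w : surjective_w w -> is_pf w.
Proof.
move=> sw; apply: count_is_pf => [x|c cw]; first by rewrite surjP // => /andP[].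
have [cm|cm] := leqP c (maxw w).
  rewrite -{1}(surj_rank sw cm) -size_filter; exact: size_undup.
have /eqP -> // : count (leq^~ c) w == size w.
by rewrite -all_count -maxw_leq ltnW.
Qed.

Lemma is_pf_le_size w x : is_pf w -> x \in w -> x <= size w.
Proof.
move=> pf; have := is_pf_count pf (leqnn _) => le.
have /allP : all (leq^~ (size w)) w by rewrite all_count eqn_leq count_size.
by apply.
Qed.

(** * Parkisation *)

(** Here [pv] and [pp] are the previous letter and its image, and [j] is the 1-based position of the
    next letter. Since [pp < j], truncation at [j] cannot undo a strict increase. *)
Lemma park_aux_bounds pv pp j s : path leq pv s -> pp < j ->
  forall i, i < size s ->
  let p := nth 0 (park_aux pv pp j s) i in
  [/\ pp <= p, p <= j + i & pv < nth 0 s i -> pp < p].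
Proof.
elim: s pv pp j => // x s IH pv pp j /= /andP[le ps] ppj [|i] /= is_.
  by split; lia.
have [|a b c] := IH x (minn (pp + (x - pv)) j) j.+1 ps _ i is_; first lia.
split; try lia.
Qed.

Lemma park_aux_mono pv pp j s : path leq pv s -> pp < j ->
  forall a b, a < b < size s -> nth 0 s a < nth 0 s b ->
  nth 0 (park_aux pv pp j s) a < nth 0 (park_aux pv pp j s) b.
Proof.
elim: s pv pp j => [|x s IH] pv pp j; first by move=> _ _ a b; rewrite ltn0 andbF.
move=> /= /andP[le ps] ppj [|a] [|b] //= ab.
  by have [|_ _] := @park_aux_bounds x (minn (pp + (x - pv)) j) j.+1 s ps _ b ab; first lia.
apply: IH => //; lia.
Qed.

(* The initial state [0, 0, 1] satisfies the invariant [pp < j] required by the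
   lemmas above, and yields the first value 1 because the letters are positive. *)
Lemma park_sortedE s : sorted leq s -> (forall x, x \in s -> 0 < x) ->
  park_sorted s = park_aux 0 0 1 s.
Proof.
case: s => //= x s _ /(_ x); rewrite inE eqxx => /(_ isT) x0.
by have -> : minn (0 + (x - 0)) 1 = 1 by lia.
Qed.

Definition park_val (w : word) (x : nat) :=
  nth 0 (park_sorted (sort leq w)) (index x (sort leq w)).

Lemma ParkE w : Park w = map (park_val w) w. Proof. by []. Qed.

Lemma size_Park w : size (Park w) = size w.
Proof. by rewrite size_map. Qed.

Section ParkPos.
Variable w : word.
Hypothesis pos : forall x, x \in w -> 0 < x.

Let s_sorted : sorted leq (sort leq w) := sort_sorted leq_total w.

Lemma park_valE : park_val w =1
  fun x => nth 0 (park_aux 0 0 1 (sort leq w)) (index x (sort leq w)).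
Proof.
by move=> x; rewrite /park_val park_sortedE // => y; rewrite mem_sort; apply: pos.
Qed.

Let s_path : path leq 0 (sort leq w).
Proof. by move: s_sorted; case: sort. Qed.

Lemma park_val_mono : {in w &, {mono park_val w : x y / x <= y}}.
Proof.
have H x y : x \in w -> y \in w -> x < y -> park_val w x < park_val w y.
  move=> xw yw xy; rewrite !park_valE; apply: park_aux_mono => //.
    rewrite index_mem mem_sort yw andbT ltnNge; apply/negP => le.
    have := sorted_leq_index leq_trans leqnn s_sorted.
    by move/(_ y x); rewrite !mem_sort => /(_ yw xw le); lia.
  by rewrite !nth_index ?mem_sort.
move=> x y xw yw; case: (ltngtP x y) => [/H|/H|->]; last by rewrite !leqnn.
  by move/(_ xw yw)/ltnW.
by move/(_ yw xw); rewrite ltnNge => /negbTE.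
Qed.

Lemma std_Park : std (Park w) = std w.
Proof. by rewrite ParkE std_map //; apply: park_val_mono. Qed.

Lemma Park_is_pf : is_pf (Park w).
Proof.
apply: (@is_pf_perm _ (map (park_val w) (sort leq w))).
- by rewrite perm_map // perm_sym perm_sort.
- move=> y /mapP[x]; rewrite mem_sort => xw ->; rewrite park_valE.
  have [|_ _ lt0] := @park_aux_bounds 0 0 1 _ s_path isT (index x (sort leq w)).
    by rewrite index_mem mem_sort.
  by apply: lt0; rewrite nth_index ?mem_sort // pos.
move=> i; rewrite size_map => iw; rewrite (nth_map 0) // park_valE.
(* The image is read at the first occurrence of the letter, whose index is at most [i], so it is
   bounded by [i.+1]. *)
have le := index_nth 0 iw.
have [|_ leb _] := @park_aux_bounds 0 0 1 _ s_path isT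
  (index (nth 0 (sort leq w) i) (sort leq w)).
  exact: leq_ltn_trans iw.
by apply: leq_trans leb _; rewrite add1n ltnS.
Qed.

End ParkPos.

(** * Splittings of parking functions *)

(* [(u, v)] is a term of the coproduct of [h]: since [u] is a parking function,
   its letters are the letters of [h] that are at most [size u], so the shuffle
   in the definition is determined. *)
Definition splits (h u v : word) : bool :=
  [&& is_pf u, is_pf v, [seq x <- h | x <= size u] == u
    & [seq x <- h | size u < x] == map (addn (size u)) v].

Lemma splits_perm h u v : splits h u v -> perm_eq (u ++ map (addn (size u)) v) h.
Proof.
case/and4P => _ _ /eqP eu /eqP ev; rewrite -{1}eu -ev.
rewrite -(permPr (permEl (perm_filterC (leq^~ (size u)) h))) perm_cat2l.
by rewrite (@eq_filter _ _ (predC (leq^~ (size u)))) // => x /=; rewrite ltnNge.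
Qed.

(** Up to [size u], the word [u] alone supplies enough small letters; beyond, all of [u] counts and
    the shifted [v] supplies the missing [c - size u]. *)
Lemma splits_is_pf h u v : splits h u v -> is_pf h.
Proof.
move=> S; have pe := splits_perm S; case/and4P: S => pu pv _ _.
apply: count_is_pf => [x|c].
  rewrite -(perm_mem pe) mem_cat => /orP[/(is_pf_posP pu) //|/mapP[y]].
  by move/(is_pf_posP pv) => y0 ->; lia.
rewrite -(perm_size pe) -(permP pe) size_cat size_map count_cat => cs.
have [cu|cu] := leqP c (size u).
  exact: leq_trans (is_pf_count pu cu) (leq_addr _ _).
have -> : count (leq^~ c) u = size u.
  apply/eqP; rewrite -all_count; apply/allP => x /(is_pf_le_size pu); lia.
have -> : count (leq^~ c) (map (addn (size u)) v) = count (leq^~ (c - size u)) v.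
  rewrite count_map; apply: eq_count => x /=; lia.
by rewrite -leq_subLR is_pf_count // leq_subLR.
Qed.

Lemma splits_rank h u v : splits h u v -> rank h (size u) = size (undup u).
Proof. by rewrite /rank => /and4P[_ _ /eqP -> _]. Qed.

Lemma filter_le_std h c :
  [seq y <- std h | y <= rank h c] = map (rank h) [seq x <- h | x <= c].
Proof.
rewrite stdE filter_map; congr map; apply: eq_in_filter => x xh /=.
by rewrite rank_le // inE xh orbT.
Qed.

Lemma filter_gt_std h c :
  [seq y <- std h | rank h c < y] = map (rank h) [seq x <- h | c < x].
Proof.
rewrite stdE filter_map; congr map; apply: eq_in_filter => x xh /=.
by rewrite rank_lt // inE xh orbT.
Qed.

(** The letters of [u] form an initial segment of those of [h], so their ranks in [u] and in [h]
    agree; the letters of [v] are the others up to a shift, which preserves their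
    standardisation. *)
Lemma splits_std h u v : splits h u v ->
  std u = [seq y <- std h | y <= rank h (size u)] /\
  std v = std [seq y <- std h | rank h (size u) < y].
Proof.
case/and4P => _ _ /eqP eu /eqP ev; rewrite filter_le_std filter_gt_std; split.
  rewrite eu stdE; apply/eq_in_map => x xu.
  have {xu} : x \in [seq x <- h | x <= size u] by rewrite eu.
  rewrite mem_filter => /andP[xu _].
  rewrite /rank -[in LHS]eu -filter_predI; congr (size (undup _)).
  by apply: eq_filter => y /=; apply/andb_idr => yx; apply: leq_trans xu.
rewrite std_map_rank; last by move=> x; rewrite mem_filter => /andP[].
by rewrite ev std_map // => x y _ _; rewrite leq_add2l.
Qed.

Lemma filter_inj (T : eqType) (a : pred T) (s t : seq T) :
  map a s = map a t -> filter a s = filter a t ->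
  filter (predC a) s = filter (predC a) t -> s = t.
Proof.
elim: s t => [|x s IH] [|y t] //= [axy est].
rewrite -axy; case: (a x) => /=.
  by case=> -> eq1 eq2; rewrite (IH t).
by move=> eq1 [-> eq2]; rewrite (IH t).
Qed.

(** An interleaving is determined by its two subwords and the pattern of low positions; this pattern
    is read off from the common standardisation, cut at the number of distinct letters of [u]. *)
Lemma splits_inj h h' u v : std h = std h' -> splits h u v -> splits h' u v -> h = h'.
Proof.
move=> e S S'; apply: (@filter_inj _ (leq^~ (size u))).
- have E g : splits g u v -> map (leq^~ (size u)) g = map (leq^~ (size (undup u))) (std g).
    move=> /splits_rank <-; rewrite stdE -map_comp; apply/eq_in_map => x xg /=.
    by rewrite rank_le // inE xg orbT.
  by rewrite E // e E.
- by case/and4P: S => _ _ /eqP -> _; case/and4P: S' => _ _ /eqP -> _.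
have E g : [seq x <- g | predC (leq^~ (size u)) x] = [seq x <- g | size u < x].
  by apply: eq_filter => x /=; rewrite ltnNge.
by rewrite !E; case/and4P: S => _ _ _ /eqP ->; case/and4P: S' => _ _ _ /eqP ->.
Qed.

Lemma unrank_mem w y : y \in std w -> unrank w y \in w.
Proof. by move=> yw; rewrite -[X in _ \in X](map_unrank w) map_f. Qed.

(** The word [h] is [f] relabelled: letters up to [i] become letters of [u], the others letters of
    [v] raised by [size u]. *)
Lemma splits_exists f u v i : surjective_w f -> is_pf u -> is_pf v ->
  std u = [seq x <- f | x <= i] -> std v = std [seq x <- f | i < x] ->
  exists2 h, splits h u v & std h = f.
Proof.
move=> sf pu pv eu ev; set g := [seq x <- f | i < x] in ev.
(* Small letters of [f] already are letters of [std u]; large ones must first be renumbered by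
   [rank g] to become letters of [std v]. *)
pose phi x := if x <= i then unrank u x else size u + unrank v (rank g x).
have lo x : x \in f -> x <= i -> x \in std u by move=> xf xi; rewrite eu mem_filter xi.
have mg x : x \in f -> i < x -> x \in g by move=> xf xi; rewrite mem_filter xi.
have hi x : x \in f -> i < x -> rank g x \in std v.
  by move=> xf xi; rewrite ev stdE map_f // mg.
(* The letters of [u] are at most its length and those of [v] are positive, so [size u] separates
   the two kinds of images. *)
have phi_le x : x \in f -> (phi x <= size u) = (x <= i).
  move=> xf; rewrite /phi; case: (leqP x i) => xi.
    by rewrite (is_pf_le_size pu) // unrank_mem // lo.
  by have := is_pf_posP pv (unrank_mem (hi x xf xi)); lia.
have mono : {in f &, {mono phi : x y / x <= y}}.
  move=> x y xf yf; have := phi_le x xf; have := phi_le y yf; rewrite /phi.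
  case: (leqP x i) => xi; case: (leqP y i) => yi; try lia.
    by move=> _ _; apply: unrank_mono; apply: lo.
  move=> _ _; rewrite leq_add2l unrank_mono ?hi // rank_le //.
  by rewrite inE mg ?orbT.
exists (map phi f); last by rewrite std_map // std_surj.
apply/and4P; split=> //; apply/eqP; rewrite filter_map.
  rewrite -[RHS]map_unrank eu (eq_in_filter (a2 := leq^~ i)); last by move=> x /phi_le.
  by apply/eq_in_map => x; rewrite mem_filter /phi => /andP[->].
rewrite (eq_in_filter (a2 := leq i.+1)); last by move=> x /phi_le /=; lia.
rewrite -/g -(map_unrank v) ev stdE -!map_comp; apply/eq_in_map => x.
by rewrite mem_filter /phi /= => /andP[xi _]; rewrite leqNgt xi.
Qed.

(** * Sums with a forced index, linear extensions and enumerations *)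

Local Open Scope ring_scope.

Lemma sum_le1 (R : nmodType) (T : eqType) (s : seq T) (t0 : T) (P : pred T) (F : T -> R) :
  uniq s -> (forall t, t \in s -> P t -> t = t0) ->
  \sum_(t <- s | P t) F t = if (t0 \in s) && P t0 then F t0 else 0.
Proof.
move=> us uP; case: ifP => [/andP[t0s Pt0]|n].
  rewrite (big_rem t0) //= Pt0 big1_seq ?addr0 // => t /andP[Pt].
  by rewrite mem_rem_uniq // inE => /andP[/eqP nt ts]; case: nt; apply: uP.
rewrite big1_seq // => t /andP[Pt ts]; move: n.
by rewrite -(uP t ts Pt) ts Pt.
Qed.

Lemma sum1_le1 (R : pzSemiRingType) (T : eqType) (s : seq T) (P : pred T) :
  uniq s -> {in s &, forall t t', P t -> P t' -> t = t'} ->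
  \sum_(t <- s | P t) 1 = (has P s)%:R :> R.
Proof.
move=> us uP; case: (boolP (has P s)) => [/hasP[t0 t0s Pt0]|/hasPn n].
  rewrite (@sum_le1 _ _ _ t0) ?t0s ?Pt0 // => t ts Pt; exact: uP.
by rewrite big1_seq // => t /andP[Pt /n]; rewrite Pt.
Qed.

(** The functional [G] is arbitrary: a delta gives coefficients, other choices unfold composites of
    linear extensions. *)
Lemma sum_lift (R : pzSemiRingType) (T U : eqType) (D : T -> seq (R * U))
    (x : seq (R * T)) (G : U -> R) :
  \sum_(p <- flatten [seq [seq (a.1 * c.1, c.2) | c <- D a.2] | a <- x]) p.1 * G p.2 =
  \sum_(a <- x) a.1 * \sum_(c <- D a.2) c.1 * G c.2.
Proof.
rewrite big_flatten big_map; apply: eq_bigr => a _.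
by rewrite big_map mulr_sumr; apply: eq_bigr => c _; rewrite mulrA.
Qed.

Lemma sum_delta (R : pzSemiRingType) (U : eqType) (x : seq (R * U)) (w : U) :
  \sum_(p <- x | p.2 == w) p.1 = \sum_(p <- x) p.1 * (p.2 == w)%:R.
Proof.
rewrite big_mkcond; apply: eq_bigr => p _.
by case: eqP; rewrite ?mulr1 ?mulr0.
Qed.

Lemma mem_words_of n N w :
  (w \in words_of n N) = (size w == n) && all (fun x => 0 < x <= N)%N w.
Proof.
elim: n w => [|n IH] [|x w] //=; first by apply/allpairsP => -[[? ?] []].
rewrite eqSS; apply/allpairsP/idP => [[[y z] /= [yN zw [-> ->]]]|].
  rewrite IH in zw; move: zw yN => /andP[-> ->]; rewrite mem_iota; lia.
case/and3P => sw xN aw; exists (x, w); split=> //=; first by rewrite mem_iota; lia.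
by rewrite IH sw.
Qed.

Lemma words_of_uniq n N : uniq (words_of n N).
Proof.
elim: n => //= n IH; apply: allpairs_uniq => //; first exact: iota_uniq.
by move=> [a b] [c d] _ _ /= [-> ->].
Qed.

Lemma mem_masks_of n m : (m \in masks_of n) = (size m == n).
Proof.
elim: n m => [|n IH] [|b m] //.
  by rewrite /masks_of; apply/allpairsP => -[[? ?] []].
rewrite eqSS -IH; apply/allpairsP/idP => [[[c z] /= [_ zm [_ ->]]] //|mm].
by exists (b, m); split=> //; case: (b).
Qed.

Lemma masks_of_uniq n : uniq (masks_of n).
Proof.
elim: n => // n IH; apply: allpairs_uniq => //.
by move=> [a b] [c d] _ _ /= [-> ->].
Qed.

Lemma is_pf_mem_words h n : is_pf h -> size h = n -> h \in words_of n n.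
Proof.
move=> ph <-; rewrite mem_words_of eqxx; apply/allP => x xh.
by rewrite (is_pf_posP ph) // is_pf_le_size.
Qed.

(** * Coefficients of [alpha] and compatibility with the products *)

Section Coefficients.
Variables (K : fieldType) (q : K).

(** The lengths force the pair to be a prefix and suffix of [w]; parking functions have letters at
    most their length, so the enumeration contains that pair. *)
Lemma coef_op_b (good : word -> bool) (norm : word -> word) rel e (f g w : word) :
  (good w -> is_pf w) -> (forall h, size (norm h) = size h) ->
  let h := take (size f) w in let k := drop (size f) w in
  coef (op_b q good norm rel e f g) w =
  if [&& good w, norm h == f, norm k == g & rel (maxw h) (maxw k)]
  then q ^+ e h k else 0.
Proof.
move=> gp sn h k; rewrite /coef /op_b big_map big_filter_cond /=.
rewrite (@sum_le1 _ _ _ (h, k)) /=.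
- rewrite cat_take_drop eqxx andbT; case: (boolP [&& good w, _, _ & _]); last by rewrite andbF.
  case/and4P => /gp pw /eqP nh /eqP nk _; rewrite andbT ifT //.
  have sh : size h = size f by rewrite -nh sn.
  have sk : size k = size g by rewrite -nk sn.
  have sw : size w = (size f + size g)%N by rewrite -(cat_take_drop (size f) w) size_cat sh sk.
  have lw x : x \in w -> (0 < x <= size f + size g)%N.
    by move=> xw; rewrite (is_pf_posP pw) // -sw is_pf_le_size.
  apply/allpairsP; exists (h, k); rewrite !mem_words_of sh sk !eqxx; split=> //=.
    by apply/allP => x /mem_take; apply: lw.
  by apply/allP => x /mem_drop; apply: lw.
- apply: allpairs_uniq; rewrite ?words_of_uniq // => -[a b] [c d] _ _ /=; exact.
rewrite /h /k => -[a b] /allpairsP[[c d] [/= ac bd [-> ->]]] /andP[_ /eqP <-].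
move: ac; rewrite mem_words_of => /andP[/eqP sc _].
by rewrite take_cat drop_cat -sc ltnn subnn take0 drop0 cats0.
Qed.

Lemma sum_alpha_b f (G : word -> K) :
  \sum_(c <- alpha_b K f) c.1 * G c.2 =
  \sum_(h <- words_of (size f) (size f) | is_pf h && (std h == f)) G h.
Proof.
by rewrite big_map big_filter; apply: eq_bigr => h _; rewrite mul1r.
Qed.

Lemma coef_alpha_b f w : coef (alpha_b K f) w = (is_pf w && (std w == f))%:R.
Proof.
rewrite /coef sum_delta (sum_alpha_b f (fun h => (h == w)%:R)).
rewrite (eq_bigr (fun h => if h == w then 1 else 0)); last by move=> h _; case: eqP.
rewrite -big_mkcondr (@sum_le1 _ _ _ w) ?words_of_uniq //; last first.
  by move=> t _ /andP[_ /eqP].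
rewrite eqxx andbT; case: (boolP (is_pf w && _)); last by rewrite andbF.
by case/andP => pw /eqP sw; rewrite is_pf_mem_words // -sw size_std.
Qed.

(** A parking function occurs only in the image of its own standardisation, with coefficient 1. *)
Lemma coef_alpha (x : lc K) w : coef (alpha x) w = if is_pf w then coef x (std w) else 0.
Proof.
rewrite /coef sum_delta.
rewrite (@sum_lift _ _ _ (@alpha_b K) _ (fun h => (h == w)%:R)).
under eq_bigr => a _ do rewrite -sum_delta -/(coef _ _) coef_alpha_b.
case: (is_pf w); last by rewrite big1 // => a _; rewrite mulr0.
by rewrite sum_delta; apply: eq_bigr => a _; rewrite eq_sym.
Qed.

Lemma coef_lin2 op (x y : lc K) w :
  coef (lin2 op x y) w = \sum_(a <- x) a.1 * \sum_(b <- y) b.1 * coef (op a.2 b.2) w.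
Proof.
rewrite /coef big_flatten big_map; apply: eq_bigr => a _.
rewrite big_flatten big_map mulr_sumr; apply: eq_bigr => b _.
by rewrite big_map !mulr_sumr; apply: eq_bigr => c _; rewrite !mulrA.
Qed.

Lemma sum_alpha (x : lc K) (G : word -> K) :
  \sum_(a <- alpha x) a.1 * G a.2 = \sum_(a <- x) a.1 *
  \sum_(h <- words_of (size a.2) (size a.2) | is_pf h && (std h == a.2)) G h.
Proof.
rewrite (@sum_lift _ _ _ (@alpha_b K)); apply: eq_bigr => a _.
by rewrite sum_alpha_b.
Qed.

Lemma capw_map (phi : nat -> nat) (h k : word) :
  {in h ++ k &, injective phi} -> capw (map phi h) (map phi k) = capw h k.
Proof.
move=> inj; rewrite /capw filter_map.
have -> : [seq x <- h | preim phi [in map phi k] x] = [seq x <- h | x \in k].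
  apply: eq_in_filter => x xh /=; apply/mapP/idP => [[y yk /inj ->] //|xk].
  - by rewrite mem_cat xh.
  - by rewrite mem_cat yk orbT.
  by exists x.
apply: size_undup_map_in => x y; rewrite !mem_filter => /andP[_ xh] /andP[_ yh].
by apply: inj; rewrite mem_cat ?xh ?yh.
Qed.

Section Product.
Variables (rel : nat -> nat -> bool) (e : word -> word -> nat).
(** The hypotheses treat the three products at once: [rel] depends only on the relative order of the
    maxima, and [e] only on the number of common letters. *)
Hypothesis rel_order : forall a b a' b',
  (a' <= b')%N = (a <= b)%N -> (b' <= a')%N = (b <= a)%N -> rel a' b' = rel a b.
Hypothesis e_capw : forall h k h' k', capw h' k' = capw h k -> e h' k' = e h k.

(** Only [h = Park h0] and [k = Park k0] can contribute on the right, and they have the same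
    standardisations as the prefix and suffix of [std w]. *)
Lemma alpha_op_b f g w :
  (if is_pf w then coef (op_b q surjective_w std rel e f g) (std w) else 0) =
  \sum_(h <- words_of (size f) (size f) | is_pf h && (std h == f))
   \sum_(k <- words_of (size g) (size g) | is_pf k && (std k == g))
    coef (op_b q is_pf Park rel e h k) w.
Proof.
set h0 := take (size f) w; set k0 := drop (size f) w.
have wE : w = h0 ++ k0 by rewrite cat_take_drop.
pose C h k := [&& is_pf w, Park h0 == h, Park k0 == k & rel (maxw h0) (maxw k0)].
transitivity (\sum_(h <- words_of (size f) (size f) | is_pf h && (std h == f))
   \sum_(k <- words_of (size g) (size g) | is_pf k && (std k == g))
    if C h k then q ^+ e h0 k0 else 0); last first.
  apply: eq_bigr => h /andP[_ /eqP sh]; apply: eq_bigr => k _.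
  rewrite coef_op_b //; last exact: size_Park.
  have -> : size h = size f by rewrite -sh size_std.
  by [].
case: (boolP (is_pf w)) => [pw|/negbTE npw]; last first.
  by rewrite big1 // => h _; rewrite big1 // => k _; rewrite /C npw.
have posh : forall x, x \in h0 -> (0 < x)%N by move=> x /mem_take; apply: is_pf_posP.
have posk : forall x, x \in k0 -> (0 < x)%N by move=> x /mem_drop; apply: is_pf_posP.
have subh : {subset h0 <= w} by move=> x /mem_take.
have subk : {subset k0 <= w} by move=> x /mem_drop.
(* Positive letters give rank [0] to [0], so [rank w] commutes with [maxw] even on an empty
   factor. *)
have rank0 : rank w 0 = 0%N.
  rewrite /rank (eq_in_filter (a2 := pred0)) ?filter_pred0 // => x /(is_pf_posP pw).
  by case: x.
have mem0 (v : word) : {subset v <= w} -> maxw v \in 0%N :: w.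
  move=> sv; have := maxw_mem v; rewrite !inE => /orP[->//|/sv ->]; exact: orbT.
rewrite coef_op_b; [|by move=> _; apply/surj_is_pf/surj_std|exact: size_std].
have -> : take (size f) (std w) = map (rank w) h0 by rewrite stdE map_take.
have -> : drop (size f) (std w) = map (rank w) k0 by rewrite stdE map_drop.
rewrite surj_std !std_map_rank // !maxw_map //; try exact: rank_homo.
rewrite (rel_order (a := maxw h0) (b := maxw k0)); try by rewrite rank_le // mem0.
rewrite (e_capw (h := h0) (k := k0)); last first.
  by apply: capw_map; rewrite -wE; apply: rank_inj.
under eq_bigr => h _ do rewrite -big_mkcondr.
(* The inner sum collapses to [k = Park k0], which passes the filter exactly when [std k0 == g]. *)
rewrite (eq_bigr (fun h => if (Park h0 == h) && ((std k0 == g) && rel (maxw h0) (maxw k0))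
    then q ^+ e h0 k0 else 0)) => [|h _]; last first.
  rewrite (@sum_le1 _ _ _ (Park k0)) ?words_of_uniq //; last first.
    by move=> k _ /andP[_ /and4P[_ _ /eqP]].
  rewrite /C pw eqxx Park_is_pf // std_Park //=.
  case: eqP => [sk|]; last by rewrite !andbF.
  by rewrite is_pf_mem_words //= ?Park_is_pf // size_Park -sk size_std.
rewrite -big_mkcondr (@sum_le1 _ _ _ (Park h0)) ?words_of_uniq //; last first.
  by move=> h _ /andP[_ /andP[/eqP]].
rewrite eqxx Park_is_pf // std_Park //=.
case: eqP => [sh|]; last by rewrite !andbF.
by rewrite is_pf_mem_words //= ?Park_is_pf // size_Park -sh size_std.
Qed.

Lemma alpha_lin2 (x y : lc K) :
  lc_eq (alpha (lin2 (op_b q surjective_w std rel e) x y))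
        (lin2 (op_b q is_pf Park rel e) (alpha x) (alpha y)).
Proof.
move=> w; rewrite coef_alpha !coef_lin2.
rewrite (sum_alpha _ (fun h =>
  \sum_(b <- alpha y) b.1 * coef (op_b q is_pf Park rel e h b.2) w)).
transitivity (\sum_(a <- x) a.1 * \sum_(b <- y) b.1 *
   if is_pf w then coef (op_b q surjective_w std rel e a.2 b.2) (std w) else 0).
  case: (is_pf w) => //; rewrite big1 // => a _.
  by rewrite big1 ?mulr0 // => b _; rewrite mulr0.
apply: eq_bigr => a _; congr (_ * _).
under [RHS]eq_bigr => h _ do
  rewrite (sum_alpha y (fun k => coef (op_b q is_pf Park rel e h k) w)).
rewrite exchange_big; apply: eq_bigr => b _.
by rewrite alpha_op_b mulr_sumr.
Qed.

End Product.

(** A surjective word is a parking function equal to its own standardisation, so [alpha] keeps its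
    coefficient; the other words have coefficient 0 in [x] and [y]. *)
Lemma alpha_inj (x y : lc K) : in_ST x -> in_ST y ->
  lc_eq (alpha x) (alpha y) -> lc_eq x y.
Proof.
move=> xS yS e w; case: (boolP (surjective_w w)) => sw.
  by have := e w; rewrite !coef_alpha surj_is_pf // std_surj.
have z (t : lc K) : in_ST t -> coef t w = 0.
  move=> /allP tS; rewrite /coef big1_seq // => p /andP[/eqP pw /tS].
  by rewrite pw (negbTE sw).
by rewrite !z.
Qed.

(** * Compatibility with the coproducts *)

(** This leaves at most one admissible shuffle for each [j]. *)
Lemma mask_le_inj (m : bitseq) (h : word) j : size m = size h ->
  all (leq^~ j) (mask m h) -> all (leq j.+1) (mask (map negb m) h) ->
  m = map (leq^~ j) h.
Proof.
elim: m h => [|b m IH] [|x h] //= [sz]; case: b => /=.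
  by case/andP => -> a b; rewrite -IH.
move=> a /andP[jx b]; rewrite -IH //; congr (_ :: _); lia.
Qed.

Lemma coef2_DeltaPQ_b h u v : coef2 (DeltaPQ_b K h) (u, v) = (splits h u v)%:R.
Proof.
rewrite /coef2 big_flatten big_map.
(* The length of the left factor forces [j = size u]. *)
transitivity (\sum_(j <- iota 0 (size h).+1)
   if (j == size u) && splits h u v then 1 else 0 : K); last first.
  rewrite -big_mkcond (@sum_le1 _ _ _ (size u)) ?iota_uniq //; last first.
    by move=> t _ /andP[/eqP].
  rewrite eqxx andTb; case: (boolP (splits _ _ _)) => S; last by rewrite andbF.
  rewrite andbT mem_iota /= add0n ltnS -(perm_size (splits_perm S)) size_cat.
  by rewrite leq_addr.
apply: eq_bigr => j _; rewrite big_map big_filter_cond.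
rewrite (@sum_le1 _ _ _ (map (leq^~ j) h)) ?masks_of_uniq //; last first.
  (* A parking function of length [j] has letters at most [j], which forces the mask. *)
  move=> m; rewrite mem_masks_of => /eqP sm /andP[/and4P[/eqP cm pm am _] _].
  apply: mask_le_inj => //; apply/allP => x /(is_pf_le_size pm).
  by rewrite size_mask // cm.
rewrite mem_masks_of size_map eqxx /= -map_comp -!filter_mask count_map.
have -> : [seq x <- h | (negb \o leq^~ j) x] = [seq x <- h | (j < x)%N].
  by apply: eq_filter => x /=; rewrite ltnNge.
congr (if _ then _ else _); apply/idP/idP.
  case/andP => /and4P[/eqP cj pu _ pv] /eqP[eu ev].
  have ju : size u = j by rewrite -eu size_filter.
  rewrite /splits ju eqxx /= -{1}eu -{1}ev pu pv eu eqxx /= -ev -map_comp.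
  apply/eqP; rewrite -[LHS]map_id; apply/eq_in_map => x; rewrite mem_filter /=; lia.
case/andP => /eqP -> /and4P[pu pv /eqP eu /eqP ev].
rewrite ev -map_comp (eq_map (addKn (size u))) map_id.
rewrite eu pu pv eqxx !andbT -size_filter.
have -> : [seq x <- h | preim (leq^~ (size u)) id x] = u by rewrite -[RHS]eu.
rewrite eqxx /=; apply/allP => _ /mapP[x xv ->].
have := is_pf_posP pv xv; lia.
Qed.

Lemma coef2_alpha2 (x : lc2 K) u v : coef2 (alpha2 x) (u, v) =
  \sum_(a <- x) a.1 *
    ((is_pf u && (std u == a.2.1)) && (is_pf v && (std v == a.2.2)))%:R.
Proof.
rewrite /coef2 big_flatten big_map; apply: eq_bigr => a _.
rewrite big_flatten big_map.
transitivity (a.1 * (coef (alpha_b K a.2.1) u * coef (alpha_b K a.2.2) v)); last first.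
  by rewrite !coef_alpha_b -natrM mulnb.
rewrite /coef mulr_suml mulr_sumr big_mkcond [RHS]big_mkcond /=.
apply: eq_bigr => b _; rewrite big_map; case: (eqVneq b.2 u) => [bu|bu].
  rewrite [RHS]mulrA mulr_sumr; apply: eq_big => // c; by rewrite xpair_eqE bu eqxx.
by rewrite big_pred0 // => c; rewrite xpair_eqE (negbTE bu).
Qed.

(** Both sums have at most one nonzero term, equal to 1, so it suffices to match the existence of
    [h] with that of a cut [i]. *)
Lemma alpha_Delta_b f u v : surjective_w f ->
  \sum_(h <- words_of (size f) (size f) | is_pf h && (std h == f)) (splits h u v)%:R =
  \sum_(i <- iota 0 (maxw f).+1)
    ((is_pf u && (std u == [seq x <- f | (x <= i)%N])) &&
     (is_pf v && (std v == std [seq x <- f | (i < x)%N])))%:R :> K.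
Proof.
move=> sf.
have toif (b : bool) : b%:R = (if b then 1 else 0) :> K by case: b.
under eq_bigr => h _ do rewrite toif.
under [RHS]eq_bigr => i _ do rewrite toif.
rewrite -big_mkcondr -big_mkcond !sum1_le1 ?words_of_uniq ?iota_uniq //.
- congr (_%:R); congr nat_of_bool; apply/hasP/hasP => [[h _]|[i]].
    case/andP => /andP[ph /eqP sh] S; have [eu ev] := splits_std S.
    (* Cutting [h] at [size u] amounts to cutting [f] at the rank of [size u]. *)
    exists (rank h (size u)).
      by rewrite mem_iota add0n ltnS -sh maxw_std rank_size.
    by case/and4P: S => -> -> _ _; rewrite -sh -eu -ev !eqxx.
  move=> _ /andP[/andP[pu /eqP eu] /andP[pv /eqP ev]].
  have [h S sh] := splits_exists sf pu pv eu ev.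
  have ph := splits_is_pf S; exists h; last by rewrite ph sh eqxx S.
  by apply: is_pf_mem_words => //; rewrite -sh size_std.
(* By surjectivity, [i] is the maximum of the letters of [f] up to [i] (0 for the empty word), so
   [std u] determines the cut. *)
- have maxE i : i \in iota 0 (maxw f).+1 -> maxw [seq x <- f | (x <= i)%N] = i.
    rewrite mem_iota add0n ltnS => /= im; apply/eqP; rewrite eqn_leq maxw_leq.
    apply/andP; split; first by apply/allP => x; rewrite mem_filter => /andP[].
    case: i im => // i im; apply: maxw_ge; rewrite mem_filter leqnn surjP //.
  move=> i i' /maxE mi /maxE mi'.
  move=> /andP[/andP[_ /eqP e] _] /andP[/andP[_ /eqP e'] _].
  by rewrite -mi -mi' -e -e'.
move=> h h' _ _ /andP[/andP[_ /eqP e] S] /andP[/andP[_ /eqP e'] S'].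
by apply: (splits_inj _ S S'); rewrite e e'.
Qed.

Lemma alpha_Delta (x : lc K) : in_ST x -> lc2_eq (DeltaPQ (alpha x)) (alpha2 (DeltaST x)).
Proof.
move=> /allP xS [u v]; rewrite coef2_alpha2 /coef2 sum_delta.
rewrite (@sum_lift _ _ _ (@DeltaPQ_b K) _ (fun p => (p == (u, v))%:R)).
rewrite (@sum_lift _ _ _ (@DeltaST_b K) _ (fun p =>
  ((is_pf u && (std u == p.1)) && (is_pf v && (std v == p.2)))%:R)).
rewrite (sum_alpha _ (fun h => \sum_(c <- DeltaPQ_b K h) c.1 * (c.2 == (u, v))%:R)).
apply: eq_big_seq => a /xS sa; congr (_ * _).
under eq_bigr => h _ do rewrite -sum_delta -/(coef2 _ _) coef2_DeltaPQ_b.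
rewrite alpha_Delta_b // big_map; apply: eq_bigr => i _.
by rewrite mul1r.
Qed.

End Coefficients.

Theorem theorem3p2 (K : fieldType) (q : K) :
  (forall x y : lc K, in_ST x -> in_ST y ->
     lc_eq (alpha x) (alpha y) -> lc_eq x y) /\
  (forall x y : lc K, in_ST_pos x -> in_ST_pos y ->
     lc_eq (alpha (lin2 (ST_succ q) x y)) (lin2 (PQ_succ q) (alpha x) (alpha y))) /\
  (forall x y : lc K, in_ST_pos x -> in_ST_pos y ->
     lc_eq (alpha (lin2 (ST_dot q) x y)) (lin2 (PQ_dot q) (alpha x) (alpha y))) /\
  (forall x y : lc K, in_ST_pos x -> in_ST_pos y ->
     lc_eq (alpha (lin2 (ST_prec q) x y)) (lin2 (PQ_prec q) (alpha x) (alpha y))) /\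
  (forall x : lc K, in_ST x ->
     lc2_eq (DeltaPQ (alpha x)) (alpha2 (DeltaST x))).
Proof.
split; first exact: alpha_inj.
split=> [x y _ _|].
  by apply: alpha_lin2 => // a b a' b' _ /=; rewrite !ltnNge => ->.
split=> [x y _ _|].
  apply: alpha_lin2 => [a b a' b' e1 e2|h k h' k' e]; last by rewrite /exp_eq e.
  by rewrite !eqnE !eqn_leq e1 e2.
split=> [x y _ _|]; last exact: alpha_Delta.
by apply: alpha_lin2 => // a b a' b' e _; rewrite !ltnNge e.
Qed.
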